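(* Let $\mathcal M$ be a family of matroids closed under formation of minors and of free products, and let $\mathbb K$ be a field of characteristic zero. Then the minor algebra of $\mathcal M$ over $\mathbb K$ is a free associative algebra, generated by the set of (isomorphism classes of) irreducible matroids belonging to $\mathcal M$.
   Context: For a matroid $M$ on $S$ write $\rho_M$ for its rank function, $\rho(M)=\rho_M(S)$, $\nu_M(A)=|A|-\rho_M(A)$, $\lambda_M(A)=\rho(M)-\rho_M(A)$. For matroids $M$ on $S$ and $N$ on $T$ with $S\cap T=\emptyset$, the free product $M\mathbin{\Box} N$ is the matroid on $S\cup T$ whose independent sets are those $A$ with $A\cap S$ independent in $M$ and $\lambda_M(A\cap S)\geq\nu_N(A\cap T)$. A family is closed under free products if the free product of (disjoint copies of) any two members is isomorphic to a member; closed under minors if every minor of a member is isomorphic to a member. A nonempty matroid $M$ is irreducible if every factorization of $M$ as a free product contains $M$ itself as a factor. The minor algebra of $\mathcal M$ is the free $\mathbb K$-module with basis the set of isomorphism classes of matroids in $\mathcal M$, with product $M\cdot N=\sum_{L} c^L_{M,N}\,L$, where $L$ ranges over isomorphism classes in $\mathcal M$ and $c^L_{M,N}$ is the number of subsets $A$ of the ground set of $L$ with $L|A\cong M$ and $L/A\cong N$. *)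

(* Defs.v *)
From HB Require Import structures.
From mathcomp Require Import all_boot all_algebra.
From Stdlib Require Import ClassicalDescription.
Set Implicit Arguments. Unset Strict Implicit. Unset Printing Implicit Defensive.
Import GRing.Theory.
Local Open Scope ring_scope.

Definition pb (P : Prop) : bool :=
  if excluded_middle_informative P then true else false.

Record rmat := RMat { mT : finType; mI : {set {set mT}} }.

Definition is_matroid (X : rmat) : Prop :=
  [/\ set0 \in mI X,
      (forall A B : {set mT X}, B \in mI X -> A \subset B -> A \in mI X) &
      (forall A B : {set mT X}, A \in mI X -> B \in mI X -> (#|A| < #|B|)%N ->
          exists2 x, x \in B :\: A & x |: A \in mI X)].

Definition rk (X : rmat) (A : {set mT X}) : nat :=
  \max_(B in mI X | B \subset A) #|B|.

Definition restr (X : rmat) (A : {set mT X}) : rmat :=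
  @RMat {x : mT X | x \in A}
        [set S : {set {x : mT X | x \in A}} | [set val x | x in S] \in mI X].

Definition contr (X : rmat) (A : {set mT X}) : rmat :=
  @RMat {x : mT X | x \notin A}
        [set S : {set {x : mT X | x \notin A}} |
           rk ([set val x | x in S] :|: A) == (#|S| + rk A)%N].

(* free product X [] Y on the disjoint union of the ground sets:
   A independent iff A_S independent in X and lambda_X(A_S) >= nu_Y(A_T) *)
Definition fprod (X Y : rmat) : rmat :=
  @RMat (mT X + mT Y)%type
    [set S : {set (mT X + mT Y)%type} |
       ([set x | inl x \in S] \in mI X) &&
       (#|[set y | inr y \in S]| - rk [set y | inr y \in S] <=
          rk [set: mT X] - rk [set x | inl x \in S])%N].

Definition iso (X Y : rmat) : Prop :=
  exists f : mT X -> mT Y, bijective f /\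
    forall S : {set mT X}, (S \in mI X) = (f @: S \in mI Y).

Definition minor_closed (M : rmat -> Prop) : Prop :=
  forall X, M X -> forall (C : {set mT X}) (D : {set mT (contr C)}),
    exists2 Z, M Z & iso (restr D) Z.

Definition fprod_closed (M : rmat -> Prop) : Prop :=
  forall X Y, M X -> M Y -> exists2 Z, M Z & iso (fprod X Y) Z.

Definition irreducible (X : rmat) : Prop :=
  (0 < #|mT X|)%N /\
  forall N1 N2, is_matroid N1 -> is_matroid N2 -> iso X (fprod N1 N2) ->
    iso N1 X \/ iso N2 X.

Definition inM (M : rmat -> Prop) (X : rmat) : Prop := exists2 Z, M Z & iso X Z.

(* The minor algebra of M over K, modelled as K-valued functions on matroids
   which are finitely supported on the isomorphism classes of members of M. *)
Section MinorAlgebra.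
Variables (K : fieldType) (M : rmat -> Prop).

Definition mbasis (X : rmat) : rmat -> K :=
  fun L => (pb (inM M L) && pb (iso L X))%:R.

Definition mone : rmat -> K :=
  fun L => (pb (inM M L) && (#|mT L| == 0%N))%:R.

(* product: bilinear extension of  P.Q = sum_L c^L_{P,Q} L, i.e.
   (f.g)(L) = sum_{A subset E(L)} f(L|A) g(L/A) for L in M *)
Definition mprod (f g : rmat -> K) : rmat -> K :=
  fun L => if pb (inM M L) then
             \sum_(A : {set mT L}) f (restr A) * g (contr A)
           else 0.

Definition mono (w : seq rmat) : rmat -> K :=
  foldr (fun X acc => mprod (mbasis X) acc) mone w.

End MinorAlgebra.

Definition gen_word (M : rmat -> Prop) (w : seq rmat) : Prop :=
  List.Forall (fun X => M X /\ irreducible X) w.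

(* two words define the same monomial of the free algebra on iso classes *)
Definition word_equiv (u v : seq rmat) : Prop := List.Forall2 iso u v.

(* Main.v *)
(** Independence in [X] is always contained in independence in the free product
    of [X | A] and [X / A] (on the same ground set), so in the weak order the
    monomial of a word is dominated by the free product of the word, where its
    coefficient is a positive integer. Unique factorization of matroids into
    irreducibles makes this a bijection between words and isomorphism classes, and
    triangularity in characteristic zero gives the theorem.

    For unique factorization, factorizations [X = X|A * X/A] correspond to free
    separators [A], i.e. sets such that [S] is independent as soon as [S] meets
    [A] in an independent set and [|S| <= rk (S :|: A)]. If [A] and [B] are free
    separators, every transposition of [A :\: B] with [B :\: A] is an automorphism
    of [X], so that up to isomorphism of the factors one may assume that the
    smaller one is contained in the larger one. *)

From HB Require Import structures.
From mathcomp Require Import all_boot all_algebra.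
From mathcomp Require Import perm zify.
From Stdlib Require Import ClassicalDescription.
(* [Defs] comes last: its [fprod] must not be shadowed by that of [finfun]. *)
Require Import Defs.
Import GRing.Theory.
Set Implicit Arguments. Unset Strict Implicit. Unset Printing Implicit Defensive.
Local Open Scope nat_scope.

(** * Rank and minors *)

Section Rank.
Variables (X : rmat) (mX : is_matroid X).
Implicit Types A B S I J : {set mT X}.

Lemma indep0 : set0 \in mI X. Proof. by case: mX. Qed.

Lemma indepS A B : B \in mI X -> A \subset B -> A \in mI X.
Proof. by case: mX => _ + _; apply. Qed.

Lemma rk_sup B A : B \in mI X -> B \subset A -> #|B| <= rk A.
Proof. by move=> iB sBA; apply: leq_bigmax_cond; rewrite iB sBA. Qed.

Lemma rk_basis A : exists2 B, B \in mI X & B \subset A /\ #|B| = rk A.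
Proof.
have h : 0 < #|[pred B in mI X | B \subset A]|.
  by apply/card_gt0P; exists set0; rewrite inE indep0 sub0set.
have [B /andP[iB sB] eB] := eq_bigmax_cond (fun B : {set mT X} => #|B|) h.
by exists B => //; split=> //; rewrite -eB.
Qed.

Lemma rk_le_card A : rk A <= #|A|.
Proof. by have [B _ [sB <-]] := rk_basis A; apply: subset_leq_card. Qed.

Lemma rkS A B : A \subset B -> rk A <= rk B.
Proof.
by move=> sAB; have [I iI [sI <-]] := rk_basis A; apply: rk_sup => //; apply: subset_trans sAB.
Qed.

Lemma rk0 : rk (set0 : {set mT X}) = 0.
Proof. by apply/eqP; rewrite -leqn0 -(cards0 (mT X)) rk_le_card. Qed.

Lemma indepE A : (A \in mI X) = (rk A == #|A|).
Proof.
apply/idP/eqP => [iA|eA].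
  by apply/eqP; rewrite eqn_leq rk_le_card rk_sup.
have [B iB [sB eB]] := rk_basis A.
suff <- : B = A by [].
by apply/eqP; rewrite eqEcard sB eB eA leqnn.
Qed.

Lemma rk_indep A : A \in mI X -> rk A = #|A|.
Proof. by rewrite indepE => /eqP. Qed.

Lemma indep_extend I A : I \in mI X -> I \subset A ->
  exists2 B, B \in mI X & [/\ I \subset B, B \subset A & #|B| = rk A].
Proof.
move: {2}(rk A - #|I|) (leqnn (rk A - #|I|)) => n.
elim: n I => [|n IHn] I leI iI sI.
  exists I => //; split=> //; apply/eqP; rewrite eqn_leq rk_sup //.
  by move: leI; rewrite leqn0 subn_eq0.
have [leAI|ltIA] := leqP (rk A) #|I|.
  by exists I => //; split=> //; apply/eqP; rewrite eqn_leq leAI rk_sup.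
have [B iB [sB eB]] := rk_basis A.
have [x] : exists2 x, x \in B :\: I & x |: I \in mI X.
  by case: mX => _ _; apply => //; rewrite eB.
rewrite inE => /andP[xI xB] ixI.
have [|||C iC [sC sCA eC]] := IHn (x |: I) => //.
- by rewrite cardsU1 xI; lia.
- by rewrite subUset sub1set (subsetP sB) // sI.
by exists C => //; split=> //; apply: subset_trans sC; apply: subsetUr.
Qed.

Lemma rkU A S : rk (S :|: A) <= #|S| + rk A.
Proof.
have [B iB [sB <-]] := rk_basis (S :|: A).
rewrite -(cardsID A B) addnC leq_add //.
  by apply/subset_leq_card/subsetP => x; rewrite inE => /andP[xA /(subsetP sB)];
    rewrite inE (negPf xA) orbF.
by apply: rk_sup; [apply: indepS iB _; apply: subsetIl | apply: subsetIr].
Qed.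

(* Submodularity in the form of decreasing marginal ranks. *)
Lemma rk_union_card S A B : rk (S :|: B) = #|S| + rk B -> A \subset B ->
  rk (S :|: A) = #|S| + rk A.
Proof.
move=> eS sAB; apply/eqP; rewrite eqn_leq rkU /=.
(* Nested bases [I], [J], [D] of [A], [B], [S :|: B]: counting forces [D :\: B = S], so [S :|: I]
   lies inside [D]. *)
have [I iI [sI eI]] := rk_basis A.
have [J iJ [sIJ sJ eJ]] := indep_extend iI (subset_trans sI sAB).
have [D iD [sJD sD eD]] := indep_extend iJ (subset_trans sJ (subsetUr S B)).
have eDB : #|D :&: B| = rk B.
  apply/eqP; rewrite eqn_leq rk_sup ?subsetIr //=; last by apply: indepS iD _; apply: subsetIl.
  by rewrite -eJ subset_leq_card // subsetI sJD.
have := cardsID B D; rewrite eDB eD eS.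
move=> e.
have eDS : #|D :\: B| = #|S| by lia.
have sDS : D :\: B \subset S.
  by apply/subsetP=> x; rewrite inE => /andP[xB xD]; move: (subsetP sD _ xD); rewrite inE (negPf xB) orbF.
have {sDS}eSD : D :\: B = S by apply/eqP; rewrite eqEcard sDS eDS leqnn.
have -> : #|S| + rk A = #|S :|: I|.
  rewrite cardsU eI (_ : S :&: I = set0) ?cards0 ?subn0 //.
  apply/setP=> x; rewrite -eSD !inE; apply/negP=> /andP[/andP[xB _] xI].
  by move: xB; rewrite (subsetP (subset_trans sI sAB)).
apply: rk_sup; last by apply: setUS.
apply: indepS iD _; rewrite -eSD subUset subsetDl /=.
exact: subset_trans sIJ _.
Qed.

Lemma rk_basis_union S A J : [disjoint S & A] -> J \in mI X -> J \subset A -> #|J| = rk A ->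
  (rk (S :|: A) == #|S| + rk A) = (S :|: J \in mI X).
Proof.
move=> dSA iJ sJ eJ; rewrite indepE // cardsU (_ : S :&: J = set0).
  rewrite cards0 subn0 eJ; apply/eqP/eqP => [h|h].
    by rewrite (rk_union_card h sJ) rk_indep // eJ.
  by apply/eqP; rewrite eqn_leq rkU -h; apply/rkS/setUS.
by apply/eqP; rewrite setI_eq0; apply: disjointWr dSA.
Qed.

End Rank.

(* [minr N X e A]: the injection [e] presents [N] as the minor
   [(X | (codom e :|: A)) / A] of [X]. *)
Definition minr (N X : rmat) (e : mT N -> mT X) (A : {set mT X}) : Prop :=
  [/\ injective e, (forall x, e x \notin A) &
      forall S : {set mT N}, (S \in mI N) = (rk (e @: S :|: A) == #|S| + rk A)].
Arguments minr : clear implicits.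

Section Minr.
Variables (N X : rmat) (e : mT N -> mT X) (A : {set mT X}).
Hypotheses (mX : is_matroid X) (hN : minr N X e A).

Lemma minr_basis J (S : {set mT N}) : J \in mI X -> J \subset A -> #|J| = rk A ->
  (S \in mI N) = (e @: S :|: J \in mI X).
Proof.
move=> iJ sJ eJ; case: hN => injE nA ->.
rewrite -(rk_basis_union mX _ iJ sJ eJ) ?card_imset //.
rewrite -setI_eq0; apply/eqP/setP=> x; rewrite !inE; apply/negP=> /andP[/imsetP[y _ ->]].
by rewrite (negPf (nA y)).
Qed.

Lemma minr_matroid : is_matroid N.
Proof.
have [J iJ [sJ eJ]] := rk_basis mX A.
have iN S := minr_basis S iJ sJ eJ.
case: hN => injE nA _.
split=> [|S S'|S S'].
- by rewrite iN imset0 set0U.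
- rewrite !iN => i sS; apply: (indepS mX i).
  by apply: setSU; apply: imsetS.
rewrite !iN => i i' lt.
have cS (U : {set mT N}) : #|e @: U :|: J| = #|U| + #|J|.
  rewrite cardsU card_imset // (_ : _ :&: _ = set0) ?cards0 ?subn0 //.
  apply/setP=> x; rewrite !inE; apply/negP=> /andP[/imsetP[y _ ->]] /(subsetP sJ).
  by rewrite (negPf (nA y)).
have [x] : exists2 x, x \in (e @: S' :|: J) :\: (e @: S :|: J) & x |: (e @: S :|: J) \in mI X.
  by case: mX => _ _; apply => //; rewrite !cS ltn_add2r.
rewrite !inE negb_or => /andP[/andP[xS xJ]]; rewrite (negPf xJ) orbF.
case/imsetP=> y yS' ex; rewrite ex in xS * => ixS.
exists y; last by rewrite iN imsetU1 -setUA.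
by rewrite inE yS' andbT; apply: contra xS => yS; apply: imset_f.
Qed.

(** The rank formula of a minor, in additive form to avoid truncated subtraction. *)
Lemma minr_rk (S : {set mT N}) : rk S + rk A = rk (e @: S :|: A).
Proof.
have [J iJ [sJ eJ]] := rk_basis mX A.
have iN S' := minr_basis S' iJ sJ eJ.
case: hN => injE nA hI; apply/eqP; rewrite eqn_leq; apply/andP; split.
  have [B iB [sB eB]] := rk_basis minr_matroid S.
  move: iB; rewrite hI eB => /eqP <-; apply: rkS => //.
  by apply: setSU; apply: imsetS.
(* [D] extends the basis [J] of [A], so its part outside [A] comes from a subset of [S] that is
   independent in [N]. *)
have [D iD [sJD sD eD]] := indep_extend mX iJ (subset_trans sJ (subsetUr (e @: S) A)).
pose B := S :&: e @^-1: D.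
rewrite -eD -(cardsID A D) addnC leq_add //; last first.
  by apply: rk_sup; [apply: indepS mX _ _ iD _; apply: subsetIl | apply: subsetIr].
have sDB : D :\: A \subset e @: B.
  apply/subsetP=> x; rewrite inE => /andP[xA xD].
  move: (subsetP sD _ xD); rewrite inE (negPf xA) orbF => /imsetP[y yS ey].
  by rewrite ey imset_f // !inE yS -ey.
apply: leq_trans (subset_leq_card sDB) _; rewrite card_imset //.
apply: rk_sup; last exact: subsetIl.
rewrite iN; apply: indepS mX _ _ iD _.
rewrite subUset sJD andbT; apply/subsetP=> x /imsetP[y].
by rewrite !inE => /andP[_ ?] ->.
Qed.

(** By the rank formula, the two independence conditions differ only by [rk A] added on both
    sides. *)
Lemma minr_comp (P : rmat) d (B : {set mT N}) : minr P N d B ->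
  minr P X (e \o d) (e @: B :|: A).
Proof.
case: hN => injE nA hI [injd nB hP]; split.
- exact: inj_comp.
- move=> x; rewrite inE negb_or nA andbT; apply/imsetP=> -[y yB] /injE ey.
  by move: (nB x); rewrite ey yB.
move=> S; rewrite hP imset_comp setUA -imsetU.
by rewrite -!minr_rk addnA eqn_add2r.
Qed.

End Minr.

Lemma minr_restr (X : rmat) (A : {set mT X}) : is_matroid X ->
  minr (restr A) X val set0.
Proof.
move=> mX; split=> [||S]; [exact: val_inj | by move=> x; rewrite inE |].
by rewrite inE setU0 rk0 // addn0 indepE // card_imset //; apply: val_inj.
Qed.

Lemma minr_contr (X : rmat) (A : {set mT X}) : minr (contr A) X val A.
Proof. by split=> [|x|S]; [exact: val_inj | exact: (valP x) | rewrite inE]. Qed.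

Lemma minr_isoP (X Y : rmat) (f : mT X -> mT Y) : is_matroid Y -> injective f ->
  (forall S : {set mT X}, (S \in mI X) = (f @: S \in mI Y)) <-> minr X Y f set0.
Proof.
move=> mY injf; split=> [h|[_ _ h] S]; last first.
  by rewrite h setU0 rk0 // addn0 indepE // card_imset.
split=> // [x|S]; first by rewrite inE.
by rewrite setU0 rk0 // addn0 h indepE // card_imset.
Qed.

Lemma lift_inj (T T' U : finType) (e : T -> U) (e' : T' -> U) :
  injective e -> injective e' -> codom e =i codom e' ->
  exists2 g : T -> T', bijective g & forall x, e' (g x) = e x.
Proof.
move=> ie ie' ec.
have h x : e x \in codom e' by rewrite -ec codom_f.
pose g x := iinv (h x).
have gE x : e' (g x) = e x by apply: f_iinv.
exists g => //; apply: inj_card_bij.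
  by move=> x y /(congr1 e'); rewrite !gE => /ie.
by rewrite -(card_codom ie) -(card_codom ie') (eq_card ec).
Qed.

(** Reduces an isomorphism between iterated minors to a comparison of contracted sets and of images
    inside one matroid. *)
Lemma minr_uniq (N N' X : rmat) e e' (A : {set mT X}) :
  minr N X e A -> minr N' X e' A -> codom e =i codom e' -> iso N N'.
Proof.
case=> ie _ hI [ie' _ hI'] ec.
have [g bg gE] := lift_inj ie ie' ec.
exists g; split=> // S.
rewrite hI hI' card_imset; last exact: bij_inj.
by rewrite -imset_comp (eq_imset (g := e)).
Qed.

(** * Isomorphisms and images of embeddings *)

Lemma iso_refl X : iso X X.
Proof. by exists id; split=> [|S]; [exists id | rewrite imset_id]. Qed.

Lemma iso_sym X Y : iso X Y -> iso Y X.
Proof.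
case=> f [[g fg gf] h]; exists g; split; first by exists f.
by move=> S; rewrite h -imset_comp (eq_imset (g := id)) ?imset_id.
Qed.

Lemma iso_trans X Y Z : iso X Y -> iso Y Z -> iso X Z.
Proof.
case=> f [bf hf] [g [bg hg]]; exists (g \o f); split; first exact: bij_comp.
by move=> S; rewrite hf hg imset_comp.
Qed.

Lemma iso_card X Y : iso X Y -> #|mT X| = #|mT Y|.
Proof. by case=> f [/bij_eq_card]. Qed.

Lemma iso_minr X Y : is_matroid Y -> iso X Y ->
  exists2 f : mT X -> mT Y, bijective f & minr X Y f set0.
Proof.
by move=> mY [f [bf h]]; exists f => //; apply/minr_isoP => //; apply: bij_inj.
Qed.

Lemma iso_matroid X Y : iso X Y -> is_matroid Y -> is_matroid X.
Proof. by move=> i mY; have [f _ h] := iso_minr mY i; apply: minr_matroid h. Qed.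

Lemma codomE (T T' : finType) (f : T -> T') : codom f =i f @: setT.
Proof.
by move=> x; apply/codomP/imsetP=> -[y]; [move=> ->; exists y | move=> _ ->; exists y].
Qed.

Lemma codom_comp_bij (T T' T'' : finType) (g : T' -> T'') (f : T -> T') :
  bijective f -> codom (g \o f) =i codom g.
Proof.
case=> f' _ ff' x; apply/codomP/codomP=> -[y ->]; first by exists (f y).
by exists (f' y); rewrite /= ff'.
Qed.

Lemma codom_comp (T T' T'' : finType) (g : T' -> T'') (f : T -> T') (A : {set T'}) :
  codom f =i A -> codom (g \o f) =i g @: A.
Proof.
move=> cf x; apply/codomP/imsetP=> [[y ->]|[y]].
  by exists (f y); rewrite -?cf ?codom_f.
by rewrite -cf => /codomP[z ->] ->; exists z.
Qed.

Lemma codom_restr (X : rmat) (A : {set mT X}) :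
  codom (val : mT (restr A) -> mT X) =i A.
Proof.
move=> x; apply/codomP/idP=> [[y ->]|xA]; first exact: (valP y).
by exists (exist _ x xA).
Qed.

Lemma codom_contr (X : rmat) (A : {set mT X}) :
  codom (val : mT (contr A) -> mT X) =i ~: A.
Proof.
move=> x; rewrite inE; apply/codomP/idP=> [[y ->]|xA]; first exact: (valP y).
by exists (exist _ x xA).
Qed.

(** * Free products and free separators *)

Lemma imset_can (T T' : finType) (f : T -> T') (g : T' -> T) (S : {set T'}) :
  cancel g f -> f @: (g @: S) = S.
Proof. by move=> gf; rewrite -imset_comp (eq_imset (g := id)) ?imset_id. Qed.

Lemma iso_restr_minr (P X : rmat) (A : {set mT X}) : is_matroid X -> iso P (restr A) ->
  exists2 e, minr P X e set0 & codom e =i A.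
Proof.
move=> mX i; have hr := minr_restr A mX.
have [f bf hf] := iso_minr (minr_matroid mX hr) i.
have := minr_comp mX hr hf; rewrite imset0 setU0 => h.
by exists (val \o f) => // x; rewrite codom_comp_bij // codom_restr.
Qed.

Lemma iso_contr_minr (Q X : rmat) (A : {set mT X}) : is_matroid X -> iso Q (contr A) ->
  exists2 e, minr Q X e A & codom e =i ~: A.
Proof.
move=> mX i; have hr := minr_contr A.
have [f bf hf] := iso_minr (minr_matroid mX hr) i.
have := minr_comp mX hr hf; rewrite imset0 set0U => h.
by exists (val \o f) => // x; rewrite codom_comp_bij // codom_contr.
Qed.

Lemma restr_iso_image (X Y : rmat) (f : mT X -> mT Y) (A : {set mT X}) :
  is_matroid Y -> minr X Y f set0 -> iso (restr A) (restr (f @: A)).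
Proof.
move=> mY hf; have mX := minr_matroid mY hf.
have := minr_comp mY hf (minr_restr A mX); rewrite imset0 setU0 => h.
apply: minr_uniq h (minr_restr _ mY) _ => x.
by rewrite codom_restr (codom_comp _ (@codom_restr _ A)).
Qed.

Lemma contr_iso_image (X Y : rmat) (f : mT X -> mT Y) (A : {set mT X}) :
  is_matroid Y -> bijective f -> minr X Y f set0 -> iso (contr A) (contr (f @: A)).
Proof.
move=> mY bf hf; have mX := minr_matroid mY hf.
have := minr_comp mY hf (minr_contr A); rewrite setU0 => h.
apply: minr_uniq h (minr_contr _) _ => x.
rewrite codom_contr (codom_comp _ (@codom_contr _ A)).
case: bf => g fg gf; rewrite -(gf x) inE !mem_imset ?inE //; exact: can_inj fg.
Qed.

(* In terms of [X], the condition [lambda(S :&: A) >= nu(S :\: A)] for the factors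
   [X | A] and [X / A] reads [#|S| <= rk (S :|: A)]. *)
Definition free_sep (X : rmat) (A : {set mT X}) : Prop :=
  forall S : {set mT X}, S :&: A \in mI X -> #|S| <= rk (S :|: A) -> S \in mI X.

(** * The weak order and independence in free products *)

Definition weak_le (X Y : rmat) : Prop :=
  exists2 f : mT X -> mT Y, bijective f &
    forall S : {set mT X}, S \in mI X -> f @: S \in mI Y.

Lemma card_sum_preim (T T' : finType) (S : {set T + T'}) :
  #|[set x | inl x \in S]| + #|[set y | inr y \in S]| = #|S|.
Proof.
rewrite -!sum1dep_card -sum1_card big_sumType /=.
by congr (_ + _); apply: eq_bigl => x.
Qed.

(** By the rank formula, the part of [S] in [A] has lambda [rk A - #|S :&: A|], and the part outside
    has nullity [#|S :\: A| - (rk (S :|: A) - rk A)]; comparing them leaves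
    [#|S| <= rk (S :|: A)]. *)
Lemma fprod_indep_image (X P Q : rmat) (A : {set mT X}) : is_matroid X ->
  iso P (restr A) -> iso Q (contr A) ->
  exists2 h : mT (fprod P Q) -> mT X, bijective h &
    forall S : {set mT (fprod P Q)}, (S \in mI (fprod P Q)) =
      (h @: S :&: A \in mI X) && (#|h @: S| <= rk (h @: S :|: A)).
Proof.
move=> mX /(iso_restr_minr mX)[e1 h1 c1] /(iso_contr_minr mX)[e2 h2 c2].
have [m1 m2] := (minr_matroid mX h1, minr_matroid mX h2).
have [i1 _ _] := h1; have [i2 _ _] := h2.
have e1A x : e1 x \in A by rewrite -c1 codom_f.
have e2A x : e2 x \notin A by have := codom_f e2 x; rewrite c2 inE.
pose h (z : mT (fprod P Q)) := match z with inl p => e1 p | inr q => e2 q end.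
have ih : injective h.
  move=> [p|q] [p'|q'] /= e; first by rewrite (i1 _ _ e).
  - by have := e2A q'; rewrite -e e1A.
  - by have := e2A q; rewrite e e1A.
  by rewrite (i2 _ _ e).
exists h.
  apply: inj_card_bij ih _; rewrite card_sum -(card_codom i1) -(card_codom i2).
  by rewrite (eq_card c1) (eq_card c2) cardsC.
move=> S; rewrite inE.
set S1 := [set x | _]; set S2 := [set y | _].
have E1 : h @: S :&: A = e1 @: S1.
  apply/setP=> x; rewrite inE; apply/andP/imsetP.
    move=> [/imsetP[[p|q] zS ->] /=]; last by rewrite (negPf (e2A q)).
    by exists p; rewrite ?inE.
  by move=> [p]; rewrite inE => zS ->; split=> //; apply/imsetP; exists (inl p).
have E2 : e2 @: S2 :|: A = h @: S :|: A.
  apply/setP=> x; rewrite !inE; case: (boolP (x \in A)); rewrite ?orbT // !orbF => xA.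
  apply/imsetP/imsetP=> [[q]|[[p|q] zS ex]].
  - by rewrite inE => zS ->; exists (inr q).
  - by move: xA; rewrite ex /= e1A.
  - by exists q; rewrite ?inE.
have I1 : (S1 \in mI P) = (e1 @: S1 \in mI X).
  exact: (minr_isoP mX i1).2 h1 S1.
rewrite E1 -I1; case: (boolP (S1 \in mI P)) => //= iS1.
rewrite (card_imset _ ih) -(card_sum_preim S) -/S1 -/S2.
have := minr_rk mX h2 S2; rewrite E2 => <-.
have := minr_rk mX h1 setT; rewrite (rk0 mX) setU0 addn0.
have -> : e1 @: setT = A by apply/setP=> x; rewrite -c1 codomE.
move=> ->; rewrite (rk_indep m1 iS1).
(* This bound and the next make both truncated subtractions exact. *)
have := rk_le_card m2 S2.
have : #|S1| <= rk A.
  by rewrite -(card_imset _ i1); apply: rk_sup; rewrite -?I1 // -E1 subsetIr.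
lia.
Qed.

Lemma fprod_weak_le (X P Q : rmat) (A : {set mT X}) : is_matroid X ->
  iso P (restr A) -> iso Q (contr A) -> weak_le X (fprod P Q).
Proof.
move=> mX iP iQ; have [h [h' hh' h'h] hI] := fprod_indep_image mX iP iQ.
exists h' => [|S iS]; first by exists h.
rewrite hI imset_can // (indepS mX iS) ?subsetIl //=.
by rewrite -(rk_indep mX iS) rkS ?subsetUl.
Qed.

Lemma free_sep_fprod (X P Q : rmat) (A : {set mT X}) : is_matroid X ->
  iso P (restr A) -> iso Q (contr A) -> free_sep A -> iso X (fprod P Q).
Proof.
move=> mX iP iQ sA; apply: iso_sym.
have [h bh hI] := fprod_indep_image mX iP iQ.
exists h; split=> // S; rewrite hI; apply/andP/idP=> [[]|iS]; first exact: sA.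
by rewrite -(rk_indep mX iS) rkS ?subsetUl // (indepS mX iS) ?subsetIl.
Qed.

Lemma weak_le_card_indep (X Y : rmat) : weak_le X Y -> #|mI X| <= #|mI Y|.
Proof.
case=> f /bij_inj injf h.
rewrite -(card_imset (mI X) (imset_inj injf)); apply/subset_leq_card/subsetP=> S.
by case/imsetP=> S' iS' ->; apply: h.
Qed.

(** Antisymmetry of the weak order: the injection between the finite families of independent sets is
    onto once the sizes agree. *)
Lemma weak_le_iso (X Y : rmat) : weak_le X Y -> #|mI Y| <= #|mI X| -> iso X Y.
Proof.
case=> f bf h le; exists f; split=> // S.
have injf := imset_inj (bij_inj bf).
have -> : mI Y = [set f @: S | S : {set mT X} in mI X].
  apply/eqP; rewrite eq_sym eqEcard card_imset // le andbT.
  by apply/subsetP=> S' /imsetP[S'' iS'' ->]; apply: h.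
by rewrite mem_imset.
Qed.

Lemma iso_card_indep (X Y : rmat) : iso X Y -> #|mI X| = #|mI Y|.
Proof.
have W U V : iso U V -> #|mI U| <= #|mI V|.
  by move=> [f [bf h]]; apply: weak_le_card_indep; exists f => // S; rewrite h.
by move=> i; apply/eqP; rewrite eqn_leq !W //; apply: iso_sym.
Qed.

Lemma weak_le_trans (X Y Z : rmat) : weak_le X Y -> weak_le Y Z -> weak_le X Z.
Proof.
case=> f bf hf [g bg hg]; exists (g \o f); first exact: bij_comp.
by move=> S iS; rewrite imset_comp; apply/hg/hf.
Qed.

Lemma preim_inl_sum (T T' : finType) (S : {set T}) (S' : {set T'}) :
  [set x | @inl T T' x \in inl @: S :|: inr @: S'] = S.
Proof.
apply/setP=> x; rewrite !inE mem_imset; last by move=> ? ? [].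
by case: (x \in S) => //=; apply/negP=> /imsetP[].
Qed.

Lemma preim_inr_sum (T T' : finType) (S : {set T}) (S' : {set T'}) :
  [set y | @inr T T' y \in inl @: S :|: inr @: S'] = S'.
Proof.
apply/setP=> x; rewrite !inE orbC mem_imset; last by move=> ? ? [].
by case: (x \in S') => //=; apply/negP=> /imsetP[].
Qed.

(** Tested against a basis of [P], where lambda vanishes, the defining inequality says that the part
    in [Q] has nullity zero. That the free product is a matroid comes from an isomorphism with a
    known matroid. *)
Lemma fprod_minors (P Q : rmat) : is_matroid P -> is_matroid Q -> is_matroid (fprod P Q) ->
  minr P (fprod P Q) inl set0 /\ minr Q (fprod P Q) inr (inl @: setT).
Proof.
move=> mP mQ mY.
have injl : injective (inl : mT P -> mT (fprod P Q)) by move=> x y [].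
have injr : injective (inr : mT Q -> mT (fprod P Q)) by move=> x y [].
have Il (S : {set mT P}) : (S \in mI P) = (inl @: S \in mI (fprod P Q)).
  rewrite -[inl @: S]setU0 -(imset0 (@inr (mT P) (mT Q))) inE preim_inl_sum preim_inr_sum.
  by rewrite cards0 andbT.
have hl : minr P (fprod P Q) inl set0 by apply/(minr_isoP mY injl).
split=> //; split=> // [x|S]; first by apply/negP=> /imsetP[].
have [J iJ [sJ eJ]] := rk_basis mP setT.
have dS : [disjoint inr @: S & inl @: [set: mT P]].
  by rewrite -setI_eq0; apply/eqP/setP=> x; rewrite !inE;
    apply/negP=> /andP[/imsetP[y _ ->] /imsetP[]].
have eT := minr_rk mY hl setT; rewrite (rk0 mY) setU0 addn0 in eT.
have eJ' : #|(inl @: J : {set mT (fprod P Q)})| = rk (inl @: setT : {set mT (fprod P Q)}).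
  by rewrite card_imset // eJ eT.
rewrite -(card_imset S injr) (rk_basis_union mY dS _ (imsetS _ sJ) eJ') -?Il //.
rewrite setUC inE preim_inl_sum preim_inr_sum.
rewrite iJ -eJ (rk_indep mP iJ) subnn leqn0 subn_eq0 indepE //=.
by rewrite eqn_leq rk_le_card.
Qed.

(** Converse of [free_sep_fprod]: the separator is the copy in [X] of the left summand. *)
Lemma fprod_free_sep (X P Q : rmat) : is_matroid X -> is_matroid P -> is_matroid Q ->
  iso X (fprod P Q) ->
  exists2 A : {set mT X}, free_sep A & iso P (restr A) /\ iso Q (contr A).
Proof.
move=> mX mP mQ /iso_sym iX; have mY := iso_matroid iX mX.
have [f bf hf] := iso_minr mX iX.
have [hl hr] := fprod_minors mP mQ mY.
have := minr_comp mX hf hl; rewrite imset0 setU0 => {}hl.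
have := minr_comp mX hf hr; rewrite setU0 => {}hr.
pose A := f @: (inl @: [set: mT P]).
have iP : iso P (restr A).
  apply: minr_uniq hl (minr_restr _ mX) _ => x.
  by rewrite codom_restr (codom_comp _ (codomE _)).
have iQ : iso Q (contr A).
  apply: minr_uniq hr (minr_contr _) _ => x.
  rewrite codom_contr (codom_comp _ (codomE _)).
  case: bf => g fg gf; rewrite -(gf x) inE !mem_imset; try exact: can_inj fg.
  case: (g x) => y; last by rewrite imset_f //; apply/esym/negP=> /imsetP[].
  by rewrite imset_f //; apply/negP=> /imsetP[].
exists A => // S iS leS.
have [h bh hI] := fprod_indep_image mX iP iQ.
(* [mI X] is contained in [C], and through [h] the family [C] is no larger than [mI (fprod P Q)].
   Counting gives equality, although [h] and [f] may differ. *)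
pose C := [set S : {set mT X} | (S :&: A \in mI X) && (#|S| <= rk (S :|: A))].
have -> : mI X = C; last by rewrite inE iS.
apply/eqP; rewrite eqEcard; apply/andP; split.
  apply/subsetP=> S' iS'; rewrite inE (indepS mX iS') ?subsetIl //=.
  by rewrite -(rk_indep mX iS') rkS ?subsetUl.
rewrite -(iso_card_indep iX).
rewrite -(card_imset (mI (fprod P Q)) (imset_inj (bij_inj bh))).
apply/subset_leq_card/subsetP=> S'; rewrite inE => hS'.
case: (bh) => h' hh' h'h.
by apply/imsetP; exists (h' @: S'); rewrite ?hI imset_can.
Qed.

(** * Heredity and exchange for free separators *)

Lemma free_sep_sub (X : rmat) (A B : {set mT X}) : is_matroid X -> free_sep A -> A \subset B ->
  free_sep ([set x | val x \in A] : {set mT (restr B)}).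
Proof.
move=> mX sA sAB S; have hr := minr_restr B mX.
have [_ _ iE] := hr.
have E : val @: ([set x | val x \in A] : {set mT (restr B)}) = A.
  apply/setP=> x; apply/imsetP/idP=> [[y]|xA]; first by rewrite inE => ? ->.
  by exists (exist _ x (subsetP sAB _ xA)); rewrite ?inE.
have rkE U : @rk (restr B) U = rk (val @: U : {set mT X}).
  by have := minr_rk mX hr U; rewrite (rk0 mX) addn0 setU0.
have iU (U : {set mT (restr B)}) : (U \in mI (restr B)) = (val @: U \in mI X).
  by rewrite inE.
rewrite !iU rkE imsetU imsetI; last by move=> ? ? _ _; apply: val_inj.
rewrite E -(card_imset S (@val_inj _ _ (mT (restr B)))).
exact: sA.
Qed.

Lemma free_sep_trans (X : rmat) (B : {set mT X}) (A : {set mT (restr B)}) : is_matroid X ->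
  free_sep B -> free_sep A -> free_sep (val @: A : {set mT X}).
Proof.
move=> mX sB sA S iS leS; have hr := minr_restr B mX.
have rkE U : @rk (restr B) U = rk (val @: U : {set mT X}).
  by have := minr_rk mX hr U; rewrite (rk0 mX) addn0 setU0.
have iU (U : {set mT (restr B)}) : (U \in mI (restr B)) = (val @: U \in mI X).
  by rewrite inE.
have sAB : val @: A \subset B by apply/subsetP=> x /imsetP[y _ ->]; apply: (valP y).
pose S' := [set x : mT (restr B) | val x \in S].
have ES : val @: S' = S :&: B.
  apply/setP=> x; rewrite inE; apply/imsetP/andP=> [[y]|[xS xB]].
    by rewrite inE => ? ->; split=> //; apply: (valP y).
  by exists (exist _ x xB); rewrite ?inE.
(* The separator [B] reduces the claim to independence of [S :&: B], which [A] then decides inside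
   [restr B]. *)
apply: sB; last by apply: leq_trans leS _; apply/rkS/setUS.
rewrite -ES -iU; apply: sA.
  rewrite iU imsetI ?ES; last by move=> ? ? _ _; apply: val_inj.
  by apply: (indepS mX iS); apply: setSI; apply: subsetIl.
rewrite rkE imsetU ES -(card_imset S' (@val_inj _ _ (mT (restr B)))) ES.
(* Adding [#|S :\: B|] restores [#|S|] on the left, and by [rkU] adjoining [S :\: B] raises the rank
   by at most that amount. *)
rewrite -(leq_add2r #|S :\: B|) cardsID addnC.
apply: leq_trans leS (leq_trans _ (rkU mX _ _)).
by apply: rkS => //; rewrite setUA [(S :\: B) :|: _]setUC setID.
Qed.

(** The new set meets [A] inside [S], is no larger than [S], and together with [A] still covers [S]
    because [a] lies in [A]. The element [b] may already be in [S]. *)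
Lemma free_sep_exchange (X : rmat) (A S : {set mT X}) a b : is_matroid X -> free_sep A ->
  a \in A -> b \notin A -> a \in S -> S \in mI X -> b |: S :\ a \in mI X.
Proof.
move=> mX sA aA bA aS iS; apply: sA.
  apply: (indepS mX iS); apply/subsetP=> x; rewrite !inE.
  by case/andP=> /orP[/eqP->|/andP[]//]; rewrite (negPf bA).
apply: (@leq_trans #|S|).
  by rewrite cardsU1 (cardsD1 a S) aS leq_add2r leq_b1.
rewrite -(rk_indep mX iS); apply: rkS => //; apply/subsetP=> x xS; rewrite !inE xS andbT.
by case: (eqVneq x a) => [->|_]; rewrite ?aA ?orbT.
Qed.

(** Only sets containing exactly one of [a] and [b] need an argument: [A] allows replacing [a] by
    [b], and [B] allows replacing [b] by [a]. *)
Lemma free_sep_swap (X : rmat) (A B : {set mT X}) a b : is_matroid X -> free_sep A -> free_sep B ->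
  a \in A :\: B -> b \in B :\: A ->
  forall S : {set mT X}, (S \in mI X) = (tperm a b @: S \in mI X).
Proof.
move=> mX sA sB; rewrite !inE => /andP[aB aA] /andP[bA bB].
have W (S : {set mT X}) : S \in mI X -> tperm a b @: S \in mI X.
  move=> iS; case aS: (a \in S); case bS: (b \in S).
  - apply: (indepS mX iS); apply/subsetP=> x /imsetP[y yS ->].
    by case: tpermP => // ->; rewrite ?aS ?bS.
  - apply: (indepS mX (free_sep_exchange mX sA aA bA aS iS)).
    apply/subsetP=> x /imsetP[y yS ->]; rewrite !inE.
    case: tpermP => [ey|ey|/eqP ya _]; rewrite ?eqxx //; last by rewrite ya yS orbT.
    by rewrite ey bS in yS.
  - apply: (indepS mX (free_sep_exchange mX sB bB aB bS iS)).
    apply/subsetP=> x /imsetP[y yS ->]; rewrite !inE.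
    case: tpermP => [ey|ey|_ /eqP yb]; rewrite ?eqxx //; last by rewrite yb yS orbT.
    by rewrite ey aS in yS.
  - apply: (indepS mX iS); apply/subsetP=> x /imsetP[y yS ->].
    by case: tpermP => // e; rewrite e ?aS ?bS in yS.
move=> S; apply/idP/idP; first exact: W.
by move/W; rewrite imset_can //; apply: tpermK.
Qed.

Lemma free_sep_image (X Y : rmat) (f : mT X -> mT Y) (A : {set mT X}) : is_matroid Y ->
  bijective f -> minr X Y f set0 -> free_sep A -> free_sep (f @: A).
Proof.
move=> mY bf hf sA S.
have [injf _ _] := hf.
have iE := (minr_isoP mY injf).2 hf.
case: bf => g fg gf.
rewrite -(imset_can S gf).
rewrite -imsetI; last by move=> ? ? _ _; apply: injf.
rewrite -imsetU -!iE card_imset // => i.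
by have := minr_rk mY hf (g @: S :|: A); rewrite (rk0 mY) addn0 setU0 => <-; apply: sA.
Qed.

Lemma free_sep_chain (X : rmat) (A B : {set mT X}) : is_matroid X -> free_sep A -> free_sep B ->
  #|A| <= #|B| ->
  exists2 B' : {set mT X}, A \subset B' &
    [/\ #|B'| = #|B|, iso (restr B) (restr B') & iso (contr B) (contr B')].
Proof.
move=> mX sA; move: {2}#|A :\: B| (leqnn #|A :\: B|) => n.
elim: n B => [|n IHn] B leAB sB leB.
  exists B; last by split=> //; apply: iso_refl.
  by rewrite -setD_eq0 -cards_eq0 -leqn0.
case: (set_0Vmem (A :\: B)) => [AB0|[a aAB]].
  exists B; last by split=> //; apply: iso_refl.
  by rewrite -setD_eq0 AB0.
(* Since [#|A| <= #|B|] and [A] is not inside [B], some [b] in [B] lies outside [A]. Transposing [a]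
   and [b] moves [a] into the image of [B] and shrinks the difference. *)
have : 0 < #|B :\: A|.
  have : 0 < #|A :\: B| by apply/card_gt0P; exists a.
  by have := cardsID A B; have := cardsID B A; rewrite setIC; lia.
case/card_gt0P=> b bBA.
have h := free_sep_swap mX sA sB aAB bBA.
have bf : bijective (tperm a b) by exists (tperm a b); apply: tpermK.
have hf : minr X X (tperm a b) set0 by apply/(minr_isoP mX (bij_inj bf)).
have cB : #|tperm a b @: B| = #|B| by rewrite card_imset //; apply: bij_inj.
have [|||B' sB' [cB' iR iC]] := IHn (tperm a b @: B).
- rewrite -ltnS; apply: leq_trans leAB.
  apply: proper_card; apply/properP; split.
    apply/subsetP=> x; rewrite !inE => /andP[xB xA]; rewrite xA andbT.
    apply: contra xB => xB; apply/imsetP; exists x => //.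
    move: aAB bBA; rewrite !inE => /andP[aB aA] /andP[bA bB].
    by case: tpermP => // ex; [rewrite -ex xB in aB | rewrite -ex xA in bA].
  exists a => //; rewrite !inE negb_and negbK; apply/orP; left.
  by apply/imsetP; exists b; rewrite ?tpermR //; case/setDP: bBA.
- exact: free_sep_image.
- by rewrite cB.
exists B' => //; rewrite cB'; split=> //.
- exact: iso_trans (restr_iso_image _ mX hf) iR.
- exact: iso_trans (contr_iso_image _ mX bf hf) iC.
Qed.

(** * Unique factorization *)

Lemma pbP (P : Prop) : reflect P (pb P).
Proof. by rewrite /pb; case: excluded_middle_informative => h; constructor. Qed.

Lemma pb_iff (P Q : Prop) : (P <-> Q) -> pb P = pb Q.
Proof. by case=> h h'; apply/pbP/pbP. Qed.

(** * Iterated minors along a chain of two subsets *)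

Definition trace_restr (X : rmat) (C A : {set mT X}) : {set mT (restr C)} := [set x | val x \in A].
Definition trace_contr (X : rmat) (A C : {set mT X}) : {set mT (contr A)} := [set x | val x \in C].

Lemma imset_trace_restr (X : rmat) (C A : {set mT X}) : A \subset C -> val @: trace_restr C A = A.
Proof.
move=> sAC; apply/setP=> x; apply/imsetP/idP=> [[y]|xA]; first by rewrite inE => ? ->.
by exists (exist _ x (subsetP sAC _ xA)); rewrite ?inE.
Qed.

Lemma imset_trace_contr (X : rmat) (A C : {set mT X}) : A \subset C -> val @: trace_contr A C :|: A = C.
Proof.
move=> sAC; apply/setP=> x; rewrite inE; apply/orP/idP=> [[/imsetP[y]|/(subsetP sAC)//]|xC].
  by rewrite inE => ? ->.
case: (boolP (x \in A)) => xA; [by right | left].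
by apply/imsetP; exists (exist _ x xA); rewrite ?inE.
Qed.

Lemma restr_restr (X : rmat) (A C : {set mT X}) : is_matroid X -> A \subset C ->
  iso (restr (trace_restr C A)) (restr A).
Proof.
move=> mX sAC; have hC := minr_restr C mX; have mC := minr_matroid mX hC.
have := minr_comp mX hC (minr_restr (trace_restr C A) mC).
rewrite imset0 setU0 => h; apply: minr_uniq h (minr_restr _ mX) _ => x.
by rewrite codom_restr (codom_comp _ (codom_restr _)) imset_trace_restr.
Qed.

Lemma contr_contr (X : rmat) (A C : {set mT X}) : is_matroid X -> A \subset C ->
  iso (contr (trace_contr A C)) (contr C).
Proof.
move=> mX sAC; have hC := minr_contr A; have mC := minr_matroid mX hC.
have := minr_comp mX hC (minr_contr (trace_contr A C)).
rewrite imset_trace_contr //.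
move=> h; apply: minr_uniq h (minr_contr _) _ => x.
rewrite codom_contr (codom_comp _ (codom_contr _)) inE.
apply/imsetP/idP=> [[y]|xC]; first by rewrite !inE => ? ->.
have xA : x \notin A by apply: contra xC; apply: (subsetP sAC).
by exists (exist _ x xA); rewrite ?inE.
Qed.

(** Both sides are presented in [X] as the minor on [C :\: A] with [A] contracted. *)
Lemma contr_restr (X : rmat) (A C : {set mT X}) : is_matroid X -> A \subset C ->
  iso (contr (trace_restr C A))
      (restr (trace_contr A C)).
Proof.
move=> mX sAC; have hC := minr_restr C mX; have hA := minr_contr A.
have := minr_comp mX hC (minr_contr (trace_restr C A)).
rewrite setU0 imset_trace_restr //.
have := minr_comp mX hA (minr_restr (trace_contr A C) (minr_matroid mX hA)).
rewrite imset0 set0U => h h'; apply: minr_uniq h' h _ => x.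
rewrite (codom_comp _ (codom_restr _)) (codom_comp _ (codom_contr _)).
apply/imsetP/imsetP=> [[y]|[y]]; rewrite !inE => hy ->.
  by exists (exist _ (val y) hy); rewrite ?inE //; apply: (valP y).
by exists (exist _ (val y) hy); rewrite ?inE //; apply: (valP y).
Qed.

Lemma contr0 (X : rmat) : is_matroid X -> iso (contr (set0 : {set mT X})) X.
Proof.
move=> mX; have h : minr X X id set0.
  by apply/(minr_isoP mX (@inj_id _)) => S; rewrite imset_id.
apply: minr_uniq (minr_contr _) h _ => x.
by rewrite codom_contr !inE; apply/esym/codomP; exists x.
Qed.

Lemma restrT (X : rmat) : is_matroid X -> iso (restr [set: mT X]) X.
Proof.
move=> mX; have h : minr X X id set0.
  by apply/(minr_isoP mX (@inj_id _)) => S; rewrite imset_id.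
apply: minr_uniq (minr_restr _ mX) h _ => x.
by rewrite codom_restr !inE; apply/esym/codomP; exists x.
Qed.

Lemma card_restr (X : rmat) (A : {set mT X}) : #|mT (restr A)| = #|A|.
Proof. by rewrite card_sig; apply: eq_card => x; rewrite inE. Qed.

Lemma card_contr (X : rmat) (A : {set mT X}) : #|mT (contr A)| = #|~: A|.
Proof. by rewrite card_sig; apply: eq_card => x; rewrite !inE. Qed.

Lemma iso_card0 (X Y : rmat) : is_matroid X -> is_matroid Y ->
  #|mT X| = 0 -> #|mT Y| = 0 -> iso X Y.
Proof.
move=> mX mY cX cY.
have nX (x : mT X) : False by have := fintype0 x.
have nY (x : mT Y) : False by have := fintype0 x.
exists (fun x => False_rect _ (nX x)); split.
  by exists (fun y => False_rect _ (nY y)) => x; [case: (nX x) | case: (nY x)].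
move=> S; have -> : S = set0 by apply/setP=> x; case: (nX x).
by rewrite imset0 !indep0.
Qed.

Definition mempty : rmat := @RMat void setT.

Lemma mempty_matroid : is_matroid mempty.
Proof.
split=> [|A B|A B]; rewrite ?inE // => _ _.
by rewrite ltnNge (leq_trans (max_card _)) // card_void.
Qed.

Definition fword (w : seq rmat) : rmat := foldr fprod mempty w.

(** More independent sets in the right factor mean larger ranks, hence a smaller nullity for the
    left factor to absorb. *)
Lemma weak_le_fprodr (P Q Q' : rmat) : is_matroid Q -> is_matroid Q' ->
  weak_le Q Q' -> weak_le (fprod P Q) (fprod P Q').
Proof.
move=> mQ mQ' [f [g fg gf] hf].
pose h (z : mT (fprod P Q)) : mT (fprod P Q') :=
  match z with inl p => inl p | inr q => inr (f q) end.
exists h.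
  exists (fun z => match z with inl p => inl p | inr q => inr (g q) end).
    by case=> //= q; rewrite fg.
  by case=> //= q; rewrite gf.
move=> S; rewrite !inE.
have -> : [set x | inl x \in h @: S] = [set x | inl x \in S].
  apply/setP=> x; rewrite !inE; apply/imsetP/idP=> [[[p|q] // zS [->]]|xS] //.
  by exists (inl x).
have -> : [set x | inr x \in h @: S] = f @: [set x | inr x \in S].
  apply/setP=> x; rewrite !inE; apply/imsetP/imsetP=> [[[p|q] // zS [->]]|[y]].
    by exists q; rewrite ?inE.
  by rewrite inE => yS ->; exists (inr y).
case/andP=> -> /=; apply: leq_trans.
rewrite card_imset; last exact: can_inj fg.
apply: leq_sub2l.
have [B iB [sB <-]] := rk_basis mQ [set x | inr x \in S].
rewrite -(card_imset B (can_inj fg)); apply: rk_sup; first exact: hf.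
exact: imsetS.
Qed.

Lemma iso_weak_le (X Y : rmat) : iso X Y -> weak_le X Y.
Proof. by case=> f [bf h]; exists f => // S; rewrite h. Qed.

Lemma weak_le_card (X Y : rmat) : weak_le X Y -> #|mT X| = #|mT Y|.
Proof. by case=> f /bij_eq_card. Qed.

Lemma iso_fprod (P P' Q Q' : rmat) : is_matroid P' -> is_matroid Q' ->
  iso P P' -> iso Q Q' -> is_matroid (fprod P' Q') -> iso (fprod P Q) (fprod P' Q').
Proof.
move=> mP' mQ' iP iQ mY; have [A sA [iA iA']] := fprod_free_sep mY mP' mQ' (iso_refl _).
by apply/iso_sym/(free_sep_fprod mY _ _ sA); [apply: iso_trans iA | apply: iso_trans iA'].
Qed.

Lemma irreducible_iso (X Y : rmat) : iso X Y -> irreducible X -> irreducible Y.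
Proof.
move=> i [c h]; split=> [|N1 N2 m1 m2 iY]; first by rewrite -(iso_card i).
by case: (h N1 N2 m1 m2 (iso_trans i iY)) => j; [left|right]; apply: iso_trans i.
Qed.

(* Of two free separators the smaller may be assumed to lie in the larger one,
   where it is still a free separator; irreducibility then forces equality. *)
Lemma irreducible_prefix_uniq (L X Y U V : rmat) (A B : {set mT L}) :
  is_matroid L -> free_sep A -> free_sep B -> #|A| <= #|B| ->
  iso X (restr A) -> iso U (contr A) -> iso Y (restr B) -> iso V (contr B) ->
  0 < #|mT X| -> irreducible Y -> iso X Y /\ iso U V.
Proof.
move=> mL sA sB leAB iX iU iY iV X0 [_ irrY].
have [B' sAB' [cB iB iB']] := free_sep_chain mL sA sB leAB.
have mB' := minr_matroid mL (minr_restr B' mL).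
have hP := iso_sym (restr_restr mL sAB').
have iF := free_sep_fprod mB' hP (iso_refl _) (free_sep_sub mL sA sAB').
have iYF := iso_trans (iso_trans iY iB) iF.
have mP := minr_matroid mL (minr_restr A mL).
have mQ := minr_matroid mB' (minr_contr (trace_restr B' A)).
(* If [Y] is the first factor, cardinality gives [A = B']; if it is the second, the first factor, a
   copy of the nonempty [X], would have to be empty. *)
case: (irrY _ _ mP mQ iYF) => j.
  have eAB : A = B'.
    apply/eqP; rewrite eqEcard sAB' cB -!card_restr.
    by rewrite (iso_card j) (iso_card iY) leqnn.
  rewrite -eAB in iB'; split; first exact: iso_trans iX j.
  exact: iso_trans iU (iso_trans (iso_sym iB') (iso_sym iV)).
have := iso_card iYF; rewrite card_sum (iso_card j) -(iso_card iX); lia.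
Qed.

(** * Closure of the family and factorization into words *)

Section Family.
Variables (M : rmat -> Prop).
Hypotheses (Hmat : forall X, M X -> is_matroid X) (Hne : exists X, M X).
Hypotheses (Hminor : minor_closed M) (Hfp : fprod_closed M).

Lemma inM_self X : M X -> inM M X.
Proof. by exists X => //; apply: iso_refl. Qed.

Lemma inM_iso L L' : iso L L' -> inM M L' -> inM M L.
Proof. by move=> i [Z MZ j]; exists Z => //; apply: iso_trans j. Qed.

Lemma inM_matroid L : inM M L -> is_matroid L.
Proof. by case=> Z /Hmat mZ /iso_matroid; apply. Qed.

(** Closure under minors speaks of contracting and then restricting; every presentation is brought
    to that form inside a representative [Z] in [M]. *)
Lemma inM_minr L N e A : inM M L -> minr N L e A -> inM M N.
Proof.
move=> [Z MZ iZ] hN; have mZ := Hmat MZ.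
have [f bf hf] := iso_minr mZ iZ.
have := minr_comp mZ hf hN; rewrite setU0.
move: (f \o e) (f @: A) => {hN}e' {A e}A hN.
have [_ nA _] := hN.
have hC := minr_contr A; have mC := minr_matroid mZ hC.
pose D : {set mT (contr A)} := [set x | val x \in codom e'].
have := minr_comp mZ hC (minr_restr D mC); rewrite imset0 set0U => hD.
have [W MW iW] := Hminor MZ D.
apply: inM_iso (iso_trans _ iW) (inM_self MW).
apply: (minr_uniq hN hD) => x; rewrite (codom_comp _ (codom_restr _)).
apply/idP/imsetP=> [/codomP[y ->]|[y]]; last by rewrite inE => ? ->.
by exists (exist _ (e' y) (nA y)); rewrite ?inE /= ?codom_f.
Qed.

Lemma inM_restr L (A : {set mT L}) : inM M L -> inM M (restr A).
Proof. by move=> iL; apply: inM_minr iL (minr_restr A (inM_matroid iL)). Qed.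

Lemma inM_contr L (A : {set mT L}) : inM M L -> inM M (contr A).
Proof. by move=> iL; apply: inM_minr iL (minr_contr A). Qed.

Lemma inM_mempty : inM M mempty.
Proof.
have [X MX] := Hne; have iX := inM_restr set0 (inM_self MX).
apply: (inM_iso _ iX); apply: iso_card0 mempty_matroid (inM_matroid iX) _ _.
  by rewrite card_void.
by rewrite card_restr cards0.
Qed.

Lemma inM_fprod P Q : M P -> inM M Q -> inM M (fprod P Q).
Proof.
move=> MP [Z MZ iQ]; have [W MW iW] := Hfp MP MZ.
apply: inM_iso (iso_trans _ iW) (inM_self MW).
by apply: iso_fprod (iso_refl _) iQ _; auto; apply: iso_matroid iW (Hmat MW).
Qed.

Lemma inM_fword w : gen_word M w -> inM M (fword w).
Proof.
elim: w => [|X w IHw] gw; first exact: inM_mempty.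
by inversion_clear gw; case: H => MX _; apply/inM_fprod/IHw.
Qed.

(** The first letters give two free separators of one matroid; comparing these identifies the
    letters and the remaining products, and the words are peeled off together. *)
Lemma fword_inj u v : gen_word M u -> gen_word M v ->
  iso (fword u) (fword v) -> word_equiv u v.
Proof.
elim: u v => [|X u IHu] [|Y v] gu gv.
- by constructor.
- move/iso_card; inversion_clear gv; case: H => _ [Y0 _].
  by rewrite card_sum card_void; lia.
- move/iso_card; inversion_clear gu; case: H => _ [X0 _].
  by rewrite card_sum card_void; lia.
move=> i; have mL := inM_matroid (inM_fword gu).
inversion_clear gu; inversion_clear gv.
case: H => MX irrX; case: H1 => MY irrY.
have mu := inM_matroid (inM_fword H0); have mv := inM_matroid (inM_fword H2).
have [A sA [iA iA']] := fprod_free_sep mL (Hmat MX) mu (iso_refl _).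
have [B sB [iB iB']] := fprod_free_sep mL (Hmat MY) mv i.
suff [iXY iuv] : iso X Y /\ iso (fword u) (fword v).
  by constructor; last exact: IHu.
(* The irreducibility used is that of the letter with the larger separator. *)
have [leAB|/ltnW leBA] := leqP #|A| #|B|.
  exact: irreducible_prefix_uniq mL sA sB leAB iA iA' iB iB' irrX.1 irrY.
have [j j'] := irreducible_prefix_uniq mL sB sA leBA iB iB' iA iA' irrY.1 irrX.
by split; apply: iso_sym.
Qed.

(* Split off a minimal nonempty free separator. *)
Lemma fword_exists L : inM M L -> exists2 w, gen_word M w & iso L (fword w).
Proof.
move: {2}#|mT L| (leqnn #|mT L|) => n.
elim: n L => [|n IHn] L cL iL; have mL := inM_matroid iL.
  exists [::]; first by constructor.
  by apply: iso_card0 mL mempty_matroid _ _; [apply/eqP; rewrite -leqn0 | rewrite card_void].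
have [c0|] := posnP #|mT L|.
  exists [::]; first by constructor.
  by apply: iso_card0 mL mempty_matroid _ _; rewrite ?card_void.
rewrite -cardsT card_gt0 => L0.
pose F (A : {set mT L}) := pb (free_sep A) && (A != set0).
have FT : F setT by rewrite /F L0 andbT; apply/pbP => S; rewrite setIT.
have [A /minsetP[/andP[/pbP sA A0] minA] _] := minset_exists FT.
have inR := inM_restr A iL; have mR := inM_matroid inR.
(* Letters must belong to [M] itself, so [restr A] is replaced by a representative. *)
have [Z MZ iZ] := inR.
have [|w gw iw] := IHn (contr A) _ (inM_contr A iL).
  rewrite card_contr; have := cardsC A; move: A0; rewrite -card_gt0; lia.
exists (Z :: w); last exact: free_sep_fprod mL (iso_sym iZ) (iso_sym iw) sA.
constructor=> //; split=> //.
apply: irreducible_iso iZ _; split; first by rewrite card_restr card_gt0.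
move=> N1 N2 m1 m2 iN; have [A1 sA1 [i1 i2]] := fprod_free_sep mR m1 m2 iN.
have sV := free_sep_trans mL sA sA1.
(* An empty separator makes the second factor the whole of [restr A]; a nonempty one is also a free
   separator of [L], so minimality makes it everything. *)
case: (eqVneq A1 set0) => [A10|A1n].
  by right; apply: iso_trans i2 _; rewrite A10; apply: contr0.
left; apply: iso_trans i1 _.
suff -> : A1 = setT by apply: restrT.
have eA : val @: A1 = A.
  apply: minA; last by apply/subsetP=> x /imsetP[y _ ->]; apply: (valP y).
  rewrite /F; apply/andP; split; first exact/pbP.
  by rewrite -card_gt0 card_imset ?card_gt0 //; apply: val_inj.
apply/eqP; rewrite eqEcard subsetT cardsT card_restr.
by rewrite -(card_imset A1 (@val_inj _ _ (mT (restr A)))) eA leqnn.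
Qed.

End Family.

(** * The minor algebra *)

Local Open Scope ring_scope.

(** Elements of the algebra are functions of the isomorphism class, while the model uses functions
    on all of [rmat]. *)
Definition iso_inv (K : Type) (f : rmat -> K) : Prop := forall L L', iso L L' -> f L = f L'.

(** Trades subsets of a minor for subsets of [X], so that double sums over iterated minors run over
    chains in one ground set. *)
Lemma sum_restr (K : nmodType) (X : rmat) (C : {set mT X}) (G : {set mT (restr C)} -> K) :
  \sum_(A : {set mT (restr C)}) G A = \sum_(A : {set mT X} | A \subset C) G (trace_restr C A).
Proof.
rewrite [RHS](reindex (fun A : {set mT (restr C)} => val @: A)) /=.
  apply: eq_big => [A|A _].
    by apply/esym/subsetP=> x /imsetP[y _ ->]; apply: (valP y).
  by congr G; apply/setP=> x; rewrite inE mem_imset //; apply: val_inj.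
exists (trace_restr C) => A sA; last exact: imset_trace_restr.
by apply/setP=> x; rewrite inE mem_imset //; apply: val_inj.
Qed.

Lemma sum_contr (K : nmodType) (X : rmat) (A : {set mT X}) (G : {set mT (contr A)} -> K) :
  \sum_(B : {set mT (contr A)}) G B = \sum_(C : {set mT X} | A \subset C) G (trace_contr A C).
Proof.
have E (B : {set mT (contr A)}) : trace_contr A (val @: B :|: A) = B.
  apply/setP=> x; rewrite !inE (negPf (valP x)) orbF mem_imset //; exact: val_inj.
rewrite [RHS](reindex (fun B : {set mT (contr A)} => val @: B :|: A)) /=.
  by apply: eq_big => [B|B _]; rewrite ?subsetUr ?E.
by exists (trace_contr A) => C h; [apply: E | apply: imset_trace_contr].
Qed.

Lemma sum_neq0 (K : nmodType) (I : finType) (F : I -> K) :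
  \sum_i F i != 0 -> exists i, F i != 0.
Proof.
move=> h; apply/existsP; apply: contraR h; rewrite negb_exists => /forallP F0.
by apply/eqP/big1 => i _; apply/eqP; rewrite -[_ == _]negbK.
Qed.

(** Plays the part of nonnegativity in [K]: in characteristic zero, sums of such elements cannot
    cancel. *)
Definition nat_valued (K : pzSemiRingType) (x : K) : Prop := exists n : nat, x = n%:R.

Lemma nat_valued_sum (K : pzSemiRingType) (I : finType) (P : pred I) (F : I -> K) :
  (forall i, nat_valued (F i)) -> nat_valued (\sum_(i | P i) F i).
Proof.
move=> nF; elim/big_ind: _ => // [|x y [n ->] [m ->]]; first by exists 0%N.
by exists (n + m)%N; rewrite natrD.
Qed.

Lemma nat_sum_neq0 (K : idomainType) (I : finType) (F : I -> K) i :
  [pchar K] =i pred0 -> (forall i, nat_valued (F i)) -> F i != 0 -> \sum_j F j != 0.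
Proof.
move=> /pcharf0P char0 nF; rewrite (bigD1 i) //=.
have [n ->] := nF i; have [m ->] := nat_valued_sum (fun j => j != i) nF.
by rewrite -natrD !char0 addn_eq0 negb_and => ->.
Qed.

(** * Associativity of the product and coefficients of monomials *)

Section Algebra.
Variables (K : fieldType) (M : rmat -> Prop).
Hypotheses (Hmat : forall X, M X -> is_matroid X) (Hne : exists X, M X).
Hypotheses (Hminor : minor_closed M) (Hfp : fprod_closed M).
Implicit Types f g h : rmat -> K.

Lemma inM_eq L L' : iso L L' -> pb (inM M L) = pb (inM M L').
Proof. by move=> i; apply: pb_iff; split; apply: inM_iso => //; apply: iso_sym. Qed.

Lemma mbasis_inv X : iso_inv (mbasis K M X).
Proof.
move=> L L' i; rewrite /mbasis (inM_eq i); congr (_ && _)%:R.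
by apply: pb_iff; split; apply: iso_trans => //; apply: iso_sym.
Qed.

Lemma mone_inv : iso_inv (mone K M).
Proof. by move=> L L' i; rewrite /mone (inM_eq i) (iso_card i). Qed.

Lemma mprod_inv f g : iso_inv f -> iso_inv g -> iso_inv (mprod M f g).
Proof.
move=> invf invg L L' i; rewrite /mprod (inM_eq i); case: pbP => // /(inM_matroid Hmat) mL'.
have [e [e' ee' e'e] he] := iso_minr mL' i.
have be : bijective e by exists e'.
rewrite [RHS](reindex (fun A : {set mT L} => e @: A)) /=.
  apply: eq_bigr => A _; congr (_ * _).
    by apply: invf; apply: restr_iso_image.
  by apply: invg; apply: contr_iso_image.
by exists (fun A : {set mT L'} => e' @: A) => A _; apply: imset_can.
Qed.

Lemma mono_inv w : iso_inv (mono K M w).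
Proof. elim: w => [|X w IHw]; [exact: mone_inv | exact: mprod_inv (@mbasis_inv X) IHw]. Qed.

(** Both sides sum [f (L|A) g ((L|C)/A) h (L/C)] over chains [A \subset C]. *)
Lemma mprodA f g h : iso_inv f -> iso_inv g -> iso_inv h ->
  mprod M f (mprod M g h) =1 mprod M (mprod M f g) h.
Proof.
move=> invf invg invh L; rewrite {1 3}/mprod; case: pbP => // iL.
have mL := inM_matroid Hmat iL.
transitivity (\sum_(A : {set mT L}) \sum_(C : {set mT L} | A \subset C)
    f (restr A) * (g (restr (trace_contr A C)) * h (contr (trace_contr A C)))).
  apply: eq_bigr => A _; rewrite /mprod.
  case: pbP => [_|[]]; last exact: inM_contr.
  by rewrite sum_contr mulr_sumr.
rewrite (exchange_big_dep xpredT) //=; apply: eq_bigr => C _.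
rewrite /mprod; case: pbP => [_|[]]; last exact: inM_restr.
rewrite sum_restr mulr_suml; apply: eq_bigr => A sAC.
rewrite (invf _ _ (restr_restr mL sAC)) (invg _ _ (contr_restr mL sAC)).
by rewrite (invh _ _ (contr_contr mL sAC)) mulrA.
Qed.

Lemma mprod1 g : iso_inv g -> (forall L, g L != 0 -> inM M L) -> mprod M (mone K M) g =1 g.
Proof.
move=> invg supg L; rewrite /mprod; case: pbP => [iL|niL]; last first.
  by apply/esym/eqP/contraT => /supg.
have mL := inM_matroid Hmat iL.
rewrite (bigD1 set0) //= big1 ?addr0 => [|A A0].
  rewrite /mone card_restr cards0 eqxx andbT (invg _ _ (contr0 mL)).
  by case: pbP => [_|[]]; [rewrite mul1r | apply: inM_restr].
by rewrite /mone card_restr cards_eq0 (negPf A0) andbF mul0r.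
Qed.

Lemma mprod_inM f g L : mprod M f g L != 0 -> inM M L.
Proof. by rewrite /mprod; case: pbP; rewrite ?eqxx. Qed.

Lemma mono_inM w L : mono K M w L != 0 -> inM M L.
Proof.
case: w => [|X w]; last exact: mprod_inM.
by rewrite /= /mone; case: pbP; rewrite ?eqxx.
Qed.

Lemma eq_mprodr f g g' : g =1 g' -> mprod M f g =1 mprod M f g'.
Proof.
by move=> e L; rewrite /mprod; case: ifP => // _; apply: eq_bigr => A _; rewrite e.
Qed.

Lemma mono_cat u v : mono K M (u ++ v) =1 mprod M (mono K M u) (mono K M v).
Proof.
elim: u => [|X u IHu] L /=.
  by rewrite mprod1 //; [apply: mono_inv | apply: mono_inM].
rewrite (eq_mprodr _ IHu) mprodA //; try exact: mono_inv.
exact: mbasis_inv.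
Qed.

(** A nonzero coefficient provides [A] with [L|A] isomorphic to the first letter and [L/A] in the
    support of the rest; [L] lies below the free product of these two minors, and induction handles
    the right factor. *)
Lemma mono_weak_le w L : gen_word M w -> mono K M w L != 0 -> weak_le L (fword w).
Proof.
elim: w L => [|X w IHw] L gw nz; have mL := inM_matroid Hmat (mono_inM nz).
  move: nz; rewrite /= /mone; case: (#|mT L| =P 0%N) => [c0 _|]; last by rewrite andbF eqxx.
  by apply/iso_weak_le/iso_card0 => //; [apply: mempty_matroid | apply: card_void].
have iL := mono_inM nz; move: nz; rewrite /= /mprod; case: pbP => // _.
case/sum_neq0 => A; rewrite mulf_eq0 negb_or => /andP[nX nw].
have iR : iso (restr A) X.
  by move: nX; rewrite /mbasis; case: pbP; case: pbP; rewrite ?andbF ?eqxx.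
inversion_clear gw.
have mw := inM_matroid Hmat (inM_fword Hmat Hne Hminor Hfp H0).
apply: weak_le_trans (fprod_weak_le mL (iso_sym iR) (iso_refl (contr A))) _.
by apply: weak_le_fprodr (IHw _ H0 nw) => //; apply: minr_matroid mL (minr_contr A).
Qed.

Lemma mono_nat_valued w L : nat_valued (mono K M w L).
Proof.
elim: w L => [|X w IHw] L /=; first by exists ((pb (inM M L) && (#|mT L| == 0%N)) : nat).
rewrite /mprod; case: ifP => _; last by exists 0%N.
apply: nat_valued_sum => A; have [n ->] := IHw (contr A).
by rewrite /mbasis -natrM; eexists.
Qed.

(** The separator cutting off the first letter contributes a nonzero term, and the natural-number
    terms cannot cancel it. *)
Lemma mono_fword_neq0 w : [pchar K] =i pred0 -> gen_word M w ->
  mono K M w (fword w) != 0.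
Proof.
move=> char0; elim: w => [|X w IHw] gw.
  rewrite /= /mone card_void eqxx andbT; case: pbP => [_|[]]; first exact: oner_neq0.
  exact: inM_mempty.
have iL := inM_fword Hmat Hne Hminor Hfp gw; have mL := inM_matroid Hmat iL.
inversion_clear gw; case: H => MX _.
have mw := inM_matroid Hmat (inM_fword Hmat Hne Hminor Hfp H0).
have [A _ [iA iA']] := fprod_free_sep mL (Hmat MX) mw (iso_refl _).
rewrite /= /mprod; case: pbP => // _.
apply: (@nat_sum_neq0 _ _ _ A) => // [B|].
  have [n ->] := mono_nat_valued w (contr B).
  by rewrite /mbasis -natrM; eexists.
rewrite mulf_neq0 //; last by rewrite -(mono_inv w iA') IHw.
rewrite /mbasis; case: pbP => [_|[]]; last exact: inM_restr.
case: pbP => [_|[]]; last exact: iso_sym.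
exact: oner_neq0.
Qed.

(** * Spanning by triangular elimination *)

Definition mono_span f : Prop := exists2 s : seq (K * seq rmat),
  List.Forall (fun p => gen_word M p.2) s &
  forall L, f L = \sum_(p <- s) p.1 * mono K M p.2 L.

Lemma mono_span_add f c w : gen_word M w ->
  mono_span (fun L => f L - c * mono K M w L) -> mono_span f.
Proof.
move=> gw [s gs e]; exists ((c, w) :: s); first by constructor.
by move=> L; rewrite big_cons -e /= addrC subrK.
Qed.

(** Makes the support countable: matroids on [n] elements are represented by members of a finite
    type. *)
Lemma ordinal_model n L : #|mT L| = n ->
  exists J : {set {set 'I_n}}, iso L (@RMat 'I_n J).
Proof.
move=> <-; have injr : injective (@enum_rank (mT L)) by apply: enum_rank_inj.
exists [set enum_rank @: S | S : {set mT L} in mI L], enum_rank; split=> [|S].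
  by exists enum_val; [apply: enum_rankK | apply: enum_valK].
by rewrite mem_imset //; apply: imset_inj.
Qed.

(* Triangular elimination: inductively on the largest number [k] of independent
   sets of a matroid of the support, and on the number of matroids of the
   support attaining it. *)
Lemma mono_span_homogeneous n k f : [pchar K] =i pred0 -> iso_inv f ->
  (forall L, f L != 0 -> [/\ inM M L, #|mT L| = n & (#|mI L| < k)%N]) -> mono_span f.
Proof.
move=> char0; elim: k f => [|k IHk] f invf supf.
  exists [::] => [|L]; first by constructor.
  by rewrite big_nil; apply/eqP/contraT => /supf[].
pose R (J : {set {set 'I_n}}) := @RMat 'I_n J.
(* Labelled models are counted, so one isomorphism class may occur several times; a strict decrease
   is all the induction asks for. *)
pose T g := [set J : {set {set 'I_n}} | (#|J| == k) && (g (R J) != 0)].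
move: {2}#|T f| (leqnn #|T f|) => m.
elim: m f invf supf => [|m IHm] f invf supf leT.
  apply: IHk => // L nz; have [iL cL ltL] := supf _ nz; split=> //.
  rewrite ltn_neqAle -ltnS ltL andbT; apply/eqP=> eL.
  have [J iJ] := ordinal_model cL.
  move: leT; rewrite leqNgt => /negP[]; apply/card_gt0P; exists J.
  by rewrite inE -(invf _ _ iJ) nz -eL (iso_card_indep iJ) /= eqxx.
case: (set_0Vmem (T f)) => [T0|[J]]; first by apply: IHm => //; rewrite T0 cards0.
rewrite inE => /andP[/eqP cJ nzJ].
have [iJ _ _] := supf _ nzJ.
have [w gw iw] := fword_exists Hmat Hminor iJ.
have nzw := mono_fword_neq0 char0 gw; rewrite -(mono_inv w iw) in nzw.
have lew L : mono K M w L != 0 -> weak_le L (R J).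
  by move/(mono_weak_le gw)/weak_le_trans; apply; apply/iso_weak_le/iso_sym.
(* This [c] cancels the coefficient at [J]; whatever else the subtraction touches lies weakly below
   [J]. *)
pose c := f (R J) / mono K M w (R J).
apply: (mono_span_add gw (c := c)); set g := (fun L => _).
have nzg L : g L != 0 -> f L != 0 \/ mono K M w L != 0.
  case: (eqVneq (f L) 0) => [f0 gL|]; [right | by left].
  by apply: contra_neq gL => w0; rewrite /g f0 w0 mulr0 subr0.
have invg : iso_inv g by move=> L L' i; rewrite /g (invf _ _ i) (mono_inv w i).
apply: IHm => // [L /nzg[/supf //|nz]|].
  have wL := lew _ nz; split; first exact: mono_inM nz.
    by rewrite (weak_le_card wL) card_ord.
  by rewrite ltnS -cJ; apply: weak_le_card_indep wL.
rewrite -ltnS; apply: leq_trans leT; apply: proper_card; apply/properP; split.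
  (* A model touched by the subtraction with as many independent sets as [J] is isomorphic to [J],
     so it was already in [T f]. *)
  apply/subsetP=> J'; rewrite !inE => /andP[cJ' /nzg[->|nz]]; first by rewrite cJ'.
  rewrite cJ'; have wJ := lew _ nz.
  by rewrite (invf _ _ (weak_le_iso wJ _)) //= cJ (eqP cJ').
exists J; rewrite !inE ?cJ ?eqxx //= negbK /g /c divfK // subrr eqxx //.
Qed.

End Algebra.

Lemma Forall_nth (T : Type) (P : T -> Prop) x0 s i :
  List.Forall P s -> (i < size s)%N -> P (nth x0 s i).
Proof.
elim: s i => // x s IHs [|i] Ps lt; inversion_clear Ps => //.
exact: IHs.
Qed.

Theorem theorem7p4 (K : fieldType) (M : rmat -> Prop)
  (Hmat : forall X, M X -> is_matroid X)
  (Hne : exists X, M X)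
  (Hminor : minor_closed M) (Hfp : fprod_closed M)
  (Hchar : [pchar K] =i pred0) :
  (* the linear map from the free algebra on irreducible classes, sending a
     word to its monomial, is multiplicative (and unital) ... *)
  (forall u v : seq rmat, gen_word M u -> gen_word M v ->
     mono K M (u ++ v) =1 mprod M (mono K M u) (mono K M v)) /\
  (* ... its image spans the minor algebra ... *)
  (forall X, M X ->
     exists (ws : seq (seq rmat)) (cs : seq K),
       [/\ size cs = size ws, List.Forall (gen_word M) ws &
           mbasis K M X =1
             (fun L => \sum_(i < size ws) cs`_i * mono K M (nth [::] ws i) L)]) /\
  (* ... and monomials of pairwise distinct words are linearly independent *)
  (forall (ws : seq (seq rmat)) (cs : seq K),
     size cs = size ws -> List.Forall (gen_word M) ws ->
     (forall i j, (i < j < size ws)%N ->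
        ~ word_equiv (nth [::] ws i) (nth [::] ws j)) ->
     (forall L, \sum_(i < size ws) cs`_i * mono K M (nth [::] ws i) L = 0) ->
     forall i, (i < size ws)%N -> cs`_i = 0).
Proof.
split; first by move=> u v _ _; apply: mono_cat.
split=> [X MX|ws cs _ gws dist sum0].
  have [|s gs es] := mono_span_homogeneous Hmat Hne Hminor Hfp (n := #|mT X|)
      (k := #|mI X|.+1) Hchar (@mbasis_inv K M X).
    move=> L; rewrite /mbasis; case: pbP => //= iL; last by rewrite eqxx.
    by case: pbP => [iX _|]; rewrite ?eqxx // (iso_card iX) (iso_card_indep iX).
  exists (map snd s), (map fst s); split; first by rewrite !size_map.
    by elim: gs => [|p s' gp _ IH]; constructor.
  move=> L; rewrite es size_map (big_nth (0, [::])) big_mkord.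
  by apply: eq_bigr => i _; rewrite !(nth_map (0, [::])).
pose W (i : 'I_(size ws)) := nth [::] ws i.
have gW i : gen_word M (W i) by apply: Forall_nth (ltn_ord i).
have dW i j : i != j -> ~ iso (fword (W i)) (fword (W j)).
  have lt_dist (i' j' : 'I_(size ws)) : (i' < j')%N -> ~ iso (fword (W i')) (fword (W j')).
    move=> lt iW; apply: (dist i' j'); first by rewrite lt ltn_ord.
    exact: (fword_inj Hmat Hne Hminor Hfp (gW i') (gW j')).
  by rewrite -val_eqE neq_ltn => /orP[/lt_dist //|/lt_dist h /iso_sym].
suff c0 (i : 'I_(size ws)) : cs`_i = 0 by move=> i lt; apply: (c0 (Ordinal lt)).
apply/eqP/contraT => ci.
(* Evaluate the relation at the free product with the most independent sets among words with nonzero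
   coefficient. Any other contributing word would have an isomorphic free product, contradicting
   [dW]. *)
have [m cm max_m] := @arg_maxnP _ i (fun i => cs`_i != 0) (fun i => #|mI (fword (W i))|) ci.
have := sum0 (fword (W m)); rewrite (bigD1 m) //= big1 ?addr0 => [/eqP|j jm].
  rewrite mulf_eq0 (negPf cm) /=.
  by rewrite (negPf (mono_fword_neq0 Hmat Hne Hminor Hfp Hchar (gW m))).
case: (eqVneq cs`_j 0) => [->|cj]; first by rewrite mul0r.
apply/eqP; rewrite mulf_eq0 (negPf cj) /=; apply/contraT => /(mono_weak_le Hmat Hne Hminor Hfp (gW j)).
by move/weak_le_iso/(_ (max_m j cj)) => iW; case: (dW m j); rewrite // eq_sym.
Qed.
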